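(* Let $d\ge 0$ be an integer, let $n\ge1$, let $X_1,\dots,X_n$ be independent random variables with a common continuous distribution function $F$, and let $\Pi(n)$ be the class of feasible policies for the sequential selection of a $d$-modal subsequence of $X_1,\dots,X_n$. For the unique optimal policy $\pi^*_n \in \Pi(n)$, i.e. the policy attaining $\sup_{\pi_n\in\Pi(n)}\mathbb{E}[U^{o,d}_n(\pi_n)]$, one has $$\mathrm{Var}[U^{o,d}_n(\pi^*_n)] \leq \mathbb{E}[U^{o,d}_n(\pi^*_n)].$$
   Context: A finite sequence $x_1,\dots,x_k$ is called $d$-modal if it makes at most $d$ turns, i.e. it is the concatenation of at most $d+1$ consecutive blocks that are alternately (weakly) increasing, decreasing, increasing, ..., with the first block increasing; blocks may have size one. Thus $d=0$ means $x_1\le\cdots\le x_k$, and $d=1$ means $x_1\le\cdots\le x_t\ge x_{t+1}\ge\cdots\ge x_k$ for some $1\le t\le k$. Let $\mathcal{F}_i=\sigma\{X_1,\dots,X_i\}$, $1\le i\le n$. The variables $X_1,\dots,X_n$ are presented one at a time; when $X_i$ is presented at time $i$ the chooser must irrevocably accept or reject it, using only $X_1,\dots,X_i$. A policy thus yields indices $1\le \tau_1<\cdots<\tau_k\le n$ of selected elements, each $\tau_j$ being a stopping time with respect to $(\mathcal{F}_i)$. A policy is feasible (belongs to $\Pi(n)$) if the selected values $X_{\tau_1},\dots,X_{\tau_k}$ always form a $d$-modal sequence. $U^{o,d}_n(\pi_n)$ is the number $k$ of elements selected by $\pi_n$. An optimal policy exists and is unique in the sense that any two optimal policies almost surely select the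 same elements. *)

(* Defs.v *)
From HB Require Import structures.
From mathcomp Require Import all_boot all_order all_algebra.
From mathcomp Require Import all_classical all_reals all_analysis.
Import Order.TTheory GRing.Theory Num.Theory.
Import numFieldNormedType.Exports.

Set Implicit Arguments.
Unset Strict Implicit.
Unset Printing Implicit Defensive.

Local Open Scope classical_set_scope.
Local Open Scope ring_scope.
Local Open Scope ereal_scope.

(* Blocks are numbered from 0, so the first block is increasing. *)
Definition monotone_block (R : realType) (j : nat) (b : seq R) : bool :=
  if odd j then sorted >=%R b else sorted <=%R b.

(* No inequality is imposed between the last term of a block and the first term
   of the next one: whichever way that step goes, it can be attached to one of
   the two blocks, so [modal 1 s] does say that [s] increases and then
   decreases. *)
Definition modal (R : realType) (d : nat) (s : seq R) : Prop :=
  exists bs : seq (seq R),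
    [/\ s = flatten bs, (size bs <= d.+1)%N, [::] \notin bs &
        forall j, (j < size bs)%N -> monotone_block j (nth [::] bs j)].

Section SequentialSelection.
Context {disp : measure_display} {T : measurableType disp} {R : realType}.
Context (P : probability T R) {n : nat}.
Implicit Types (X : 'I_n -> {RV P >-> R}) (pol : T -> {set 'I_n}).

Definition mutually_independent X : Prop :=
  forall (J : {set 'I_n}) (B : 'I_n -> set R), (forall i, measurable (B i)) ->
    P (\bigcap_(i in [set` J]) (X i @^-1` B i)) =
    \prod_(i in J) P (X i @^-1` B i).

(* The sigma-algebra generated by [X j] for [j <= i]. *)
Definition history X (i : 'I_n) : set (set T) :=
  g_sigma_preimage (fun j : 'I_i.+1 => X (widen_ord (ltn_ord i) j) : T -> R).

(* A policy is represented by the random set of the accepted indices: the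
   decision at time [i] is the event that [i] belongs to that set. *)
Definition nonanticipating X pol : Prop :=
  forall i : 'I_n, history X i [set w | i \in pol w].

(* [enum] lists a set of ordinals in increasing order. *)
Definition selected_values X pol (w : T) : seq R :=
  [seq X i w | i <- enum (pol w)].

Definition feasible (d : nat) X pol : Prop :=
  nonanticipating X pol /\ forall w, modal d (selected_values X pol w).

Definition nb_selected pol (w : T) : R := (#|pol w|)%:R.

Definition optimal (d : nat) X pol : Prop :=
  feasible d X pol /\
  'E_P[nb_selected pol] =
    ereal_sup [set 'E_P[nb_selected pol'] | pol' in feasible d X].

End SequentialSelection.

(* Main.v *)
Require Import Defs.
From HB Require Import structures.
From mathcomp Require Import all_boot all_order all_algebra.
From mathcomp Require Import all_classical all_reals all_analysis.
From mathcomp Require Import measurable_realfun ring lra.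
Import Order.TTheory GRing.Theory Num.Theory.
Import numFieldNormedType.Exports.

(* Greedily, a selection is d-modal iff cutting it into as few alternating
   blocks as possible uses at most d+1 blocks, so the future depends on the past
   only through the last selected value and the current number of blocks. Let
   V_k be the Bellman value of that state before X_k is seen, N_k the number of
   selections made so far and Y_k = N_k + V_k(state). Since V_k decreases along
   every selection, the improvement brought by seeing one variable lies
   between 0 and 1, and it almost surely vanishes unless an optimal policy
   selects that variable. Hence the
   conditional variance of the martingale increment Y_{k+1} - Y_k is at most the
   conditional mean of the squared improvement, which is at most the conditional
   probability of a selection; summing over k gives Var <= E. *)

Set Implicit Arguments.
Unset Strict Implicit.
Unset Printing Implicit Defensive.

Local Open Scope classical_set_scope.
Local Open Scope ring_scope.

(** * Greedy decomposition of a sequence into alternating monotone blocks *)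

Section Blocks.
Context {R : realType}.
Implicit Types (s : R * nat) (x y : R) (b l : seq R) (bs : seq (seq R)).

Definition in_order (j : nat) : rel R := if odd j then <=%R else >=%R.

(* A state is the last selected value and the number of blocks of the greedy
   decomposition; with 0 blocks nothing is selected yet and the value is junk.
   Counting from 1, the odd-numbered blocks are the increasing ones. *)
Definition push s x : R * nat :=
  (x, if s.2 == 0%N then 1%N else if in_order s.2 s.1 x then s.2 else s.2.+1).

Definition blocks l : R * nat := foldl push (0, 0%N) l.

(* Any continuation allowed from [s'] is allowed from [s], whatever the last
   values when [s] has strictly fewer blocks. *)
Definition dominates s s' : bool :=
  [|| s.2 < s'.2, s.2 == 0 | (s.2 == s'.2) && in_order s.2 s.1 s'.1]%N.

Lemma in_order_refl j x : in_order j x x.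
Proof. by rewrite /in_order; case: odd => /=. Qed.

Lemma in_order_trans j : transitive (in_order j).
Proof. by rewrite /in_order; case: odd; [exact: le_trans | exact: ge_trans]. Qed.

Lemma monotone_blockE j b : monotone_block j b = sorted (in_order j.+1) b.
Proof. by rewrite /monotone_block /in_order /=; case: odd. Qed.

Lemma push_ge s x : (s.2 <= (push s x).2)%N.
Proof. by rewrite /=; case: eqP => [->//|_]; case: ifP. Qed.

Lemma push_le s x : ((push s x).2 <= s.2.+1)%N.
Proof. by rewrite /=; case: eqP => [->//|_]; case: ifP. Qed.

Lemma dominates_push s x : dominates s (push s x).
Proof.
rewrite /dominates /=; case: (s.2 == 0)%N; first by rewrite orbT.
by case: ifP => _; rewrite ?ltnSn ?eqxx ?orbT.
Qed.

(** One value opens at most one block, so a strict lead in the number of blocks is never reversed;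
    at equal numbers, transitivity shows that [x] extends the block of [s] whenever it extends that
    of [s']. *)
Lemma push_mono s s' x : dominates s s' -> ((push s x).2 <= (push s' x).2)%N.
Proof.
have h s1 : (0 < (push s1 x).2)%N.
  by rewrite /=; case: eqP => // /eqP; rewrite -lt0n => ?; case: ifP.
case/or3P => [ss'|/eqP s0|/andP[/eqP ss' o]].
- apply: leq_trans (push_le s x) _; exact: leq_trans ss' (push_ge s' x).
- by rewrite [X in (X <= _)%N]/= s0; exact: h.
- rewrite /= -ss'; case: eqP => // _.
  case: ifP => sx; case: ifP => // s'x.
  by rewrite (in_order_trans o s'x) in sx.
Qed.

(** A run monotone in the direction of block [j.+1] extends that block once the greedy count has
    reached it; below that, each value adds at most one block. *)
Lemma foldl_push_sorted j s b : (s.2 <= j.+1)%N ->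
  path (in_order j.+1) s.1 b -> ((foldl push s b).2 <= j.+1)%N.
Proof.
elim: b s => [|x b IH] s sj //= /andP[sx pb]; apply: IH => //=.
case: eqP => // _; move: sj; rewrite leq_eqVlt => /predU1P[sj|].
  by rewrite sj sx.
by case: ifP => // _ /ltnW.
Qed.

(** Minimality of the greedy count: the first value of each given block opens at most one greedy
    block, and [foldl_push_sorted] absorbs the rest. *)
Lemma blocks_flatten bs :
  (forall j, (j < size bs)%N -> monotone_block j (nth [::] bs j)) ->
  ((blocks (flatten bs)).2 <= size bs)%N.
Proof.
elim/last_ind: bs => [//|bs b IH] mbs.
have := mbs (size bs); rewrite size_rcons nth_rcons ltnn eqxx monotone_blockE.
move=> /(_ (ltnSn _)) sb.
rewrite flatten_rcons /blocks foldl_cat -/(blocks _).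
have {IH}: ((blocks (flatten bs)).2 <= size bs)%N.
  apply: IH => j jbs; have := mbs j; rewrite size_rcons nth_rcons jbs; apply.
  exact: leqW.
case: b {mbs} sb => [_ /leqW//|x b /= pb sbs].
apply: foldl_push_sorted => //; apply: leq_trans (push_le _ _) _.
by rewrite ltnS.
Qed.

(** The greedy blocks themselves witness the count. The last conjunct ties the state to the end of
    the final block, so that the induction can decide whether [x] extends it; the default [0]
    matches the initial state. *)
Lemma blocks_modal l : exists bs : seq (seq R),
  [/\ l = flatten bs, size bs = (blocks l).2, [::] \notin bs,
      forall j, (j < size bs)%N -> monotone_block j (nth [::] bs j) &
      last 0 (last [::] bs) = (blocks l).1].
Proof.
elim/last_ind: l => [|l x [bs [lE sbs nbs mbs lbs]]]; first by exists [::].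
rewrite /blocks foldl_rcons -/(blocks l).
have new : exists bs0 : seq (seq R),
  [/\ rcons l x = flatten bs0, size bs0 = (blocks l).2.+1, [::] \notin bs0,
      forall j, (j < size bs0)%N -> monotone_block j (nth [::] bs0 j) &
      last 0 (last [::] bs0) = x].
  exists (rcons bs [:: x]); split.
  - by rewrite flatten_rcons -lE cats1.
  - by rewrite size_rcons sbs.
  - by rewrite mem_rcons inE.
  - move=> j; rewrite size_rcons nth_rcons ltnS leq_eqVlt => /predU1P[->|jbs].
      by rewrite ltnn eqxx monotone_blockE.
    by rewrite jbs mbs.
  - by rewrite last_rcons.
rewrite /push /=; case: eqP => [bl0|bl0].
  by move: new; rewrite bl0.
case: ifP => // o.
case/lastP: bs => [|bs b] in lE sbs nbs mbs lbs *; first by case: bl0.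
rewrite flatten_rcons in lE; rewrite last_rcons in lbs.
have := mbs (size bs); rewrite size_rcons nth_rcons ltnn eqxx monotone_blockE.
move=> /(_ (ltnSn _)) sb.
move: nbs; rewrite mem_rcons inE negb_or => /andP[bN nbs].
exists (rcons bs (rcons b x)); split.
- by rewrite flatten_rcons lE -!cats1 catA.
- by rewrite size_rcons -sbs size_rcons.
- rewrite mem_rcons inE negb_or nbs andbT.
  by case: (b).
- move=> j; rewrite size_rcons nth_rcons ltnS leq_eqVlt => /predU1P[->|jbs].
    rewrite ltnn eqxx monotone_blockE.
    move: o; rewrite -sbs size_rcons -lbs.
    by case: (b) bN sb => // y b' _ /= yb'; rewrite rcons_path yb'.
  have := mbs j; rewrite jbs size_rcons nth_rcons jbs; apply; exact: leqW.
- by rewrite !last_rcons.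
Qed.

Lemma modalP d l : modal d l <-> ((blocks l).2 <= d.+1)%N.
Proof.
split=> [[bs [-> sbs _ mbs]]|ld].
  exact: leq_trans (blocks_flatten mbs) sbs.
have [bs [lE sbs nbs mbs _]] := blocks_modal l.
by exists bs; split => //; rewrite sbs.
Qed.

End Blocks.

(** * Bounded measurable functions and their integrals *)

Section BoundedMeasurable.
Context {disp} {T : measurableType disp} {R : realType}.
Implicit Types f g : T -> R.

Definition bounded_mfun f :=
  measurable_fun setT f /\ exists M, forall x, `|f x| <= M.

Lemma bounded_mfun_cst c : bounded_mfun (fun=> c).
Proof. by split=> //; exists `|c|. Qed.

Lemma bounded_mfunD f g : bounded_mfun f -> bounded_mfun g ->
  bounded_mfun (fun x => f x + g x).
Proof.
move=> [mf [M fM]] [mg [N gN]]; split; first exact: measurable_funD.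
by exists (M + N) => x; rewrite (le_trans (ler_normD _ _))// lerD.
Qed.

Lemma bounded_mfunM f g : bounded_mfun f -> bounded_mfun g ->
  bounded_mfun (fun x => f x * g x).
Proof.
move=> [mf [M fM]] [mg [N gN]]; split; first exact: measurable_funM.
by exists (M * N) => x; rewrite normrM ler_pM.
Qed.

Lemma bounded_mfunB f g : bounded_mfun f -> bounded_mfun g ->
  bounded_mfun (fun x => f x - g x).
Proof.
move=> [mf [M fM]] [mg [N gN]]; split; first exact: measurable_funB.
by exists (M + N) => x; rewrite (le_trans (ler_normB _ _))// lerD.
Qed.

Lemma bounded_mfun_sqr f : bounded_mfun f -> bounded_mfun (fun x => f x ^+ 2).
Proof. by move=> bf; exact: bounded_mfunM. Qed.

Context (P : probability T R).

Lemma bounded_mfun_integrable f :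
  bounded_mfun f -> P.-integrable setT (EFin \o f).
Proof.
move=> [mf [M fM]]; apply: measurable_bounded_integrable => //.
  exact: fin_num_fun_lty.
exists M; split; first exact: num_real.
by move=> x Mx y _ /=; apply: le_trans (fM y) (ltW Mx).
Qed.

Lemma RintegralD_bounded f g : bounded_mfun f -> bounded_mfun g ->
  \int[P]_x (f x + g x) = \int[P]_x f x + \int[P]_x g x.
Proof. by move=> bf bg; rewrite RintegralD//; exact: bounded_mfun_integrable. Qed.

Lemma RintegralB_bounded f g : bounded_mfun f -> bounded_mfun g ->
  \int[P]_x (f x - g x) = \int[P]_x f x - \int[P]_x g x.
Proof. by move=> bf bg; rewrite RintegralB//; exact: bounded_mfun_integrable. Qed.

Lemma RintegralZ_bounded c f : bounded_mfun f ->
  \int[P]_x (c * f x) = c * \int[P]_x f x.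
Proof. by move=> bf; rewrite RintegralZl//; exact: bounded_mfun_integrable. Qed.

Lemma le_Rintegral_bounded f g : bounded_mfun f -> bounded_mfun g ->
  (forall x, f x <= g x) -> \int[P]_x f x <= \int[P]_x g x.
Proof.
by move=> bf bg fg; apply: le_Rintegral => //; exact: bounded_mfun_integrable.
Qed.

Lemma Rintegral_probability_cst c : \int[P]_x c = c.
Proof. by rewrite Rintegral_cst//= probability_setT mulr1. Qed.

End BoundedMeasurable.

(** * Integrating out one of two independent variables *)

Section IndependentPair.
Context {d1 d2 d3} {T : measurableType d1} {S : measurableType d2}
  {S' : measurableType d3} {R : realType} (P : probability T R).

(** Independence makes the joint law agree with the product measure on rectangles, hence everywhere;
    Tonelli's theorem then iterates the integral. *)
Lemma integral_independent (W : {mfun T >-> S}) (Y : {mfun T >-> S'})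
    (f : S * S' -> \bar R) :
  (forall A B, measurable A -> measurable B ->
    P (W @^-1` A `&` Y @^-1` B) = P (W @^-1` A) * P (Y @^-1` B))%E ->
  measurable_fun setT f -> (forall z, 0 <= f z)%E ->
  (\int[P]_w f (W w, Y w) = \int[P]_w \int[distribution P Y]_y f (W w, y))%E.
Proof.
move=> WY mf f0.
have mWY : measurable_fun setT (fun w => (W w, Y w)).
  exact: measurable_fun_pair.
pose WY' : {mfun T >-> (S * S')%type} := HB.pack (fun w => (W w, Y w))
  (isMeasurableFun.Build _ _ _ _ _ mWY).
transitivity (\int[distribution P WY']_z f z)%E.
  by rewrite ge0_integral_pushforward.
transitivity (\int[distribution P W \x distribution P Y]_z f z)%E.
  apply: eq_measure_integral => A mA _.
  by apply/esym/product_measure_unique => // B C mB mC; exact: WY.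
rewrite fubini_tonelli1//= ge0_integral_pushforward//.
  exact: measurable_fun_fubini_tonelli_F.
by move=> x _; apply: integral_ge0.
Qed.

Lemma Rintegral_independent (W : {mfun T >-> S}) (Y : {mfun T >-> S'})
    (f : S * S' -> R) :
  (forall A B, measurable A -> measurable B ->
    P (W @^-1` A `&` Y @^-1` B) = P (W @^-1` A) * P (Y @^-1` B))%E ->
  bounded_mfun f -> (forall z, 0 <= f z) ->
  \int[P]_w f (W w, Y w) = \int[P]_w \int[distribution P Y]_y f (W w, y).
Proof.
move=> WY bf f0; rewrite [LHS]/Rintegral.
rewrite (integral_independent (f := EFin \o f) WY)//; last first.
  by apply/measurable_EFinP; case: bf.
congr fine; apply: eq_integral => w _; rewrite fineK//.
apply: integrable_fin_num => //; apply: bounded_mfun_integrable.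
case: bf => mf [M fM]; split; last by exists M.
exact: measurableT_comp mf _.
Qed.

Lemma bounded_mfun_Rintegral (Q : probability S' R) (f : S * S' -> R) :
  bounded_mfun f -> (forall z, 0 <= f z) ->
  bounded_mfun (fun s => \int[Q]_y f (s, y)).
Proof.
move=> bf f0; have bs s : bounded_mfun (fun y => f (s, y)).
  case: bf => mf [M fM]; split; last by exists M.
  exact: measurableT_comp mf _.
split.
  apply/measurable_EFinP; rewrite [X in measurable_fun _ X](_ : _ =
    (fun s => \int[Q]_y (f (s, y))%:E)%E); last first.
    apply/funext => s /=; rewrite fineK//; apply: integrable_fin_num => //.
    exact: bounded_mfun_integrable.
  apply: (@measurable_fun_fubini_tonelli_F _ _ _ _ _ Q (EFin \o f)) => //.
  by apply/measurable_EFinP; case: bf.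
case: (bf) => _ [M fM]; exists M => s.
rewrite ger0_norm ?Rintegral_ge0//.
rewrite -[leRHS](Rintegral_probability_cst Q).
apply: le_Rintegral_bounded => //; first exact: bounded_mfun_cst.
by move=> y; rewrite (le_trans (ler_norm _))//.
Qed.

End IndependentPair.

(** * Bellman recursion for the expected number of selections to come *)

Section Value.
Context {R : realType} (d : nat).
Implicit Types (v : R * nat -> R) (s : R * nat) (x : R).

(** The better of rejecting and accepting [x] when the future is worth [v]. A forbidden acceptance
    counts as [0], which never beats rejection for nonnegative [v]. *)
Definition gain v s x : R :=
  Num.max (v s) (if ((push s x).2 <= d.+1)%N then 1 + v (push s x) else 0).

Lemma measurable_fun_nat {dS} {S' : measurableType dS} (f : nat -> S') :
  measurable_fun setT f.
Proof. by []. Qed.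

Lemma measurable_push :
  measurable_fun setT (fun z : R * nat * R => push z.1 z.2).
Proof.
have m1 : measurable_fun setT (fun z : R * nat * R => z.1.1).
  exact: measurableT_comp measurable_fst measurable_fst.
have m2 dS (S' : measurableType dS) (f : nat -> S') :
    measurable_fun setT (fun z : R * nat * R => f z.1.2).
  apply: (measurableT_comp (measurable_fun_nat f)).
  exact: measurableT_comp measurable_snd measurable_fst.
apply: measurable_fun_pair => //=.
apply: measurable_fun_ifT; first exact: (m2 _ _ (fun k => k == 0%N)).
  exact: measurable_cst.
apply: measurable_fun_ifT; [|exact: (m2 _ _ id)|exact: (m2 _ _ S)].
rewrite [X in measurable_fun _ X](_ : _ = fun z : R * nat * R =>
  if odd z.1.2 then z.1.1 <= z.2 else z.2 <= z.1.1); last first.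
  by apply/funext => z; rewrite /in_order; case: odd.
apply: measurable_fun_ifT; first exact: (m2 _ _ odd).
  exact: measurable_fun_ler.
exact: measurable_fun_ler.
Qed.

Lemma measurable_gain v : measurable_fun setT v ->
  measurable_fun setT (fun z : R * nat * R => gain v z.1 z.2).
Proof.
move=> mv; apply: measurable_maxr; first exact: measurableT_comp mv _.
apply: measurable_fun_ifT.
- apply: (measurableT_comp (measurable_fun_nat (fun k => (k <= d.+1)%N))).
  exact: measurableT_comp measurable_snd measurable_push.
- apply: measurable_funD; first exact: measurable_cst.
  exact: measurableT_comp mv measurable_push.
- exact: measurable_cst.
Qed.

Definition monotone_state v := forall s s', dominates s s' -> v s' <= v s.

Lemma gain_ge v s x : v s <= gain v s x.
Proof. by rewrite le_max lexx. Qed.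

(** Acceptance leads to a dominated state, whose future is worth no more, so seeing [x] adds at most
    the one selection itself. *)
Lemma gain_le v s x : (forall s, 0 <= v s) -> monotone_state v ->
  gain v s x <= 1 + v s.
Proof.
move=> v0 mv; rewrite ge_max lerDr ler01 /=; case: ifP => _.
  by rewrite lerD2l mv// dominates_push.
by rewrite addr_ge0.
Qed.

(** By [push_mono], an acceptance allowed from [s'] is allowed from [s]; both resulting states end
    in [x], so only their numbers of blocks have to be compared. *)
Lemma gain_mono v s s' x : (forall s, 0 <= v s) -> monotone_state v ->
  dominates s s' -> gain v s' x <= gain v s x.
Proof.
move=> v0 mv ss'; rewrite ge_max (le_trans (mv _ _ ss')) ?gain_ge//=.
case: ifP => s'd; last by rewrite le_max v0.
have pss' := push_mono x ss'.
rewrite le_max (leq_trans pss' s'd) lerD2l; apply/orP; right; apply: mv.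
rewrite /dominates; move: pss'; rewrite leq_eqVlt => /predU1P[e|->//].
by rewrite e eqxx in_order_refl !orbT.
Qed.

Lemma bounded_gain v : bounded_mfun v -> (forall s, 0 <= v s) ->
  monotone_state v -> bounded_mfun (fun z : R * nat * R => gain v z.1 z.2).
Proof.
move=> [mvl [M vM]] v0 mv; split; first exact: measurable_gain.
exists (1 + M) => z; rewrite ger0_norm; last exact: le_trans (gain_ge _ _ _).
rewrite (le_trans (gain_le _ _ v0 mv))// lerD2l.
exact: le_trans (ler_norm _) (vM _).
Qed.

Lemma bounded_gain_section v s : bounded_mfun v -> (forall s, 0 <= v s) ->
  monotone_state v -> bounded_mfun (gain v s).
Proof.
move=> bv v0 mv; have [mg [M gM]] := bounded_gain bv v0 mv.
split; last by exists M => x; exact: (gM (s, x)).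
exact: (measurable_fun_pair2 s mg).
Qed.

(* Expanding the square at [a + v s], the increment [gain v s x - v s] lies in
   [0, 1] and hence dominates its own square. *)
Lemma second_moment_gain (Q : probability R R) v (a : R) s :
  bounded_mfun v -> (forall s, 0 <= v s) -> monotone_state v ->
  \int[Q]_x (a + gain v s x) ^+ 2 <=
  (a + \int[Q]_x gain v s x) ^+ 2 + (\int[Q]_x gain v s x - v s).
Proof.
move=> bv v0 mv; have bg := bounded_gain_section s bv v0 mv.
set h := \int[Q]_x gain v s x.
pose c := a + v s.
have -> : (a + h) ^+ 2 + (h - v s) =
    (h - v s) ^+ 2 + ((c ^+ 2 - (2 * c + 1) * v s) + (2 * c + 1) * h).
  by rewrite /c; ring.
apply: (@le_trans _ _ ((c ^+ 2 - (2 * c + 1) * v s) + (2 * c + 1) * h));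
    last first.
  by rewrite lerDr sqr_ge0.
have bl : bounded_mfun (fun x => (2 * c + 1) * gain v s x).
  by apply: bounded_mfunM => //; exact: bounded_mfun_cst.
rewrite /h -RintegralZ_bounded//.
rewrite -[X in _ <= X + _](Rintegral_probability_cst Q).
rewrite -RintegralD_bounded//; last exact: bounded_mfun_cst.
apply: le_Rintegral_bounded.
- apply: bounded_mfun_sqr; apply: bounded_mfunD => //; exact: bounded_mfun_cst.
- by apply: bounded_mfunD => //; exact: bounded_mfun_cst.
- move=> x; rewrite /c.
  have := gain_ge v s x; have := gain_le s x v0 mv.
  move: (gain v s x) => g g1 g0.
  have : (g - v s) ^+ 2 <= g - v s.
    by rewrite expr2 ler_piMr ?subr_ge0// lerBlDr.
  rewrite -subr_ge0 => H; rewrite -subr_ge0; apply: le_trans H _.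
  by rewrite le_eqVlt; apply/orP; left; apply/eqP; ring.
Qed.

Context {I : Type} (mu : I -> probability R R).

(* [l] lists the indices of the variables still to come. *)
Fixpoint value (l : seq I) s : R :=
  if l is i :: l' then \int[mu i]_x gain (value l') s x else 0.

(** Proved together: bounding the gain requires sign and monotonicity, and [gain_mono] carries
    monotonicity over only for nonnegative values. *)
Lemma valueP l : [/\ bounded_mfun (value l), forall s, 0 <= value l s &
  monotone_state (value l)].
Proof.
elim: l => [|i l [bv v0 mv]] /=.
  by split=> //; exact: bounded_mfun_cst.
have bg := bounded_gain bv v0 mv.
have g0 (z : R * nat * R) : 0 <= gain (value l) z.1 z.2.
  exact: le_trans (gain_ge _ _ _).
split.
- exact: (bounded_mfun_Rintegral (mu i) bg g0).
- by move=> s; apply: Rintegral_ge0 => x _; exact: (g0 (s, x)).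
- move=> s s' ss'; apply: le_Rintegral_bounded.
  + exact: bounded_gain_section.
  + exact: bounded_gain_section.
  + by move=> x; exact: gain_mono.
Qed.

End Value.

(** * Sigma-algebras of past observations and independence from the next variable *)

Section Past.
Context {disp} {T : measurableType disp} {R : realType} (P : probability T R)
  {n : nat} (X : 'I_n -> {RV P >-> R}).

(** Counting observations by a natural number includes [k = 0], the trivial information available
    before anything is seen. *)
Definition past_gen (k : nat) : set (set T) := [set A |
  exists2 j : 'I_n, (j < k)%N & exists2 B, measurable B & A = X j @^-1` B].

(** A copy of [T] carrying the smaller sigma-algebra, so that adaptedness becomes [measurable_fun]
    on this copy. *)
Definition past (k : nat) := g_sigma_algebraType (past_gen k).

Lemma past_measurable k (A : set T) : <<s past_gen k>> A -> measurable A.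
Proof.
move: A; apply: smallest_sub; first exact: sigma_algebra_measurable.
by move=> _ [j _ [B mB ->]]; rewrite -[_ @^-1` _]setTI; exact: measurable_funP.
Qed.

Lemma past_mono k k' : (k <= k')%N ->
  <<s past_gen k>> `<=` <<s past_gen k'>>.
Proof.
move=> kk'; apply: smallest_sub; first exact: smallest_sigma_algebra.
move=> _ [j jk [B mB ->]]; apply: sub_sigma_algebra; exists j.
  exact: leq_trans kk'.
by exists B.
Qed.

Lemma measurable_fun_past {dS} {S : measurableType dS} k (f : T -> S) :
  measurable_fun (setT : set (past k)) f -> measurable_fun setT f.
Proof. by move=> mf _ B mB; apply: (@past_measurable k); exact: mf. Qed.

Lemma measurable_fun_past_mono {dS} {S : measurableType dS} k k' (f : T -> S) :
  (k <= k')%N -> measurable_fun (setT : set (past k)) f ->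
  measurable_fun (setT : set (past k')) f.
Proof. by move=> kk' mf _ B mB; apply: (past_mono kk'); exact: mf. Qed.

Lemma measurable_past_X (i : 'I_n) k : (i < k)%N ->
  measurable_fun (setT : set (past k)) (X i).
Proof.
move=> ik _ B mB; rewrite setTI; apply: sub_sigma_algebra.
by exists i => //; exists B.
Qed.

(** The history at time [i] contains [X i] itself, hence the successor. *)
Lemma history_past (i : 'I_n) : history X i = <<s past_gen i.+1>>.
Proof.
congr (<<s _ >>); apply/seteqP; split=> A.
  rewrite -bigcup_mkord_ord => -[j _ [B mB <-]].
  rewrite setTI; exists (widen_ord (ltn_ord i) (inord j)) => /=.
    by rewrite ltn_ord.
  by exists B.
case=> j ji [B mB ->]; rewrite -bigcup_mkord_ord; exists j => //.
exists B => //; rewrite setTI.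
suff -> : widen_ord (ltn_ord i) (inord j) = j by [].
by apply/val_inj; rewrite /= inordK.
Qed.

(** Uniqueness of measures on a generating class closed under intersection: as functions of [A],
    both sides are finite measures, and they agree on cylinders by mutual independence. *)
Lemma past_independent (i : 'I_n) (A : set T) (B : set R) :
  mutually_independent X -> <<s past_gen i>> A -> measurable B ->
  (P (A `&` X i @^-1` B) = P A * P (X i @^-1` B))%E.
Proof.
move=> indX pA mB.
pose cyl := [set C : set T | exists2 D : 'I_n -> set R,
  forall j, measurable (D j) &
  C = \bigcap_(j in [set` [set j : 'I_n | (j < i)%N]%SET]) X j @^-1` D j].
have mXB j (D : set R) : measurable D -> measurable (X j @^-1` D).
  by move=> mD; rewrite -[_ @^-1` _]setTI; exact: measurable_funP.
have cylm : cyl `<=` measurable.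
  move=> _ [D mD ->]; apply: fin_bigcap_measurable => //= j _; exact: mXB.
have cA : <<s cyl>> A.
  move: A pA; apply: smallest_sub; first exact: smallest_sigma_algebra.
  move=> _ [j ji [D mD ->]]; apply: sub_sigma_algebra.
  exists (fun j' => if j' == j then D else setT); first by move=> j'; case: ifP.
  apply/seteqP; split=> w /=.
    by move=> Dw j' _ /=; case: eqP => [->|].
  by move=> /(_ j); rewrite /= inE eqxx; apply.
have cylT : cyl setT.
  exists (fun=> setT) => //; apply/seteqP; split=> //.
have cylI : setI_closed cyl.
  move=> _ _ [D mD ->] [D' mD' ->]; exists (fun j => D j `&` D' j).
    by move=> j; exact: measurableI.
  rewrite -bigcapI; apply: eq_bigcapr => j _; by rewrite preimage_setI.
have mD := mXB i B mB.
pose m1 := mrestr P mD.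
have r0 : 0 <= fine (P (X i @^-1` B)) by rewrite fine_ge0.
pose m2 := mscale (NngNum r0) P.
suff -> : (P (A `&` X i @^-1` B) = m2 A)%E.
  by rewrite /m2 /mscale /= fineK ?fin_num_measure// muleC.
rewrite -[LHS]/(m1 A).
apply: (@g_sigma_algebra_measure_unique _ _ _ cyl cylm (fun=> setT)) => //.
- by rewrite bigcup_const.
- move=> C [D mD' CE]; rewrite /m1 /m2 /= /mrestr /mscale /=.
  rewrite fineK ?fin_num_measure// CE indX//.
  (* Independence over the indices up to [i], with [B] placed at [i], splits off the factor of
     [X i]. *)
  pose D' j := if j == i then B else D j.
  have := indX (i |: [set j : 'I_n | (j < i)%N])%SET D'.
  rewrite big_setU1 ?inE ?ltnn//= /D' eqxx.
  rewrite (eq_bigr (fun j => P (X j @^-1` D j))); last first.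
    by move=> j; rewrite inE; case: eqP => // ->; rewrite ltnn.
  rewrite muleC => <-; last by move=> j; case: ifP.
  congr (P _); apply/seteqP; split=> w /=.
    move=> [Dw Bw] j /=; rewrite !inE; case: eqP => [->//|_ /= ji].
    by apply: Dw; rewrite /= inE.
  move=> H; split.
    move=> j /=; rewrite inE => ji; have := H j; rewrite /= !inE ji orbT.
    by case: eqP ji => [->|_ _]; [rewrite ltnn|apply].
  by have := H i; rewrite /= !inE eqxx; apply.
- move=> k; rewrite /m1 /= /mrestr setTI.
  by rewrite ltey_eq fin_num_measure.
Qed.

(** Plays the role of conditioning on the past: what is known before time [i] is frozen and [X i] is
    averaged against its own law. *)
Lemma Rintegral_past {dS} {S : measurableType dS} (i : 'I_n) (W : T -> S)
    (f : S * R -> R) :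
  mutually_independent X -> measurable_fun (setT : set (past i)) W ->
  bounded_mfun f -> (forall z, 0 <= f z) ->
  \int[P]_w f (W w, X i w) = \int[P]_w \int[distribution P (X i)]_x f (W w, x).
Proof.
move=> indX mW bf f0.
pose W' : {mfun T >-> S} := HB.pack W
  (isMeasurableFun.Build _ _ _ _ _ (measurable_fun_past mW)).
apply: (Rintegral_independent (W := W')) => // A B mA mB.
apply: past_independent => //.
by have := mW measurableT A mA; rewrite setTI.
Qed.

End Past.

(** * Anticipated number of selections along a policy *)

Section Policies.
Context {disp : measure_display} {T : measurableType disp} {R : realType}
  (P : probability T R) {d n : nat} (X : 'I_n -> {RV P >-> R}).
Context (indX : mutually_independent X).
Implicit Types pol : T -> {set 'I_n}.

Definition law (i : 'I_n) : probability R R := distribution P (X i).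

Definition to_come (k : nat) : R * nat -> R := value d law (drop k (enum 'I_n)).

Definition state pol (k : nat) (w : T) : R * nat :=
  foldl (fun s i => if i \in pol w then push s (X i w) else s) (0, 0%N)
    (take k (enum 'I_n)).

Definition nb_before pol (k : nat) (w : T) : R :=
  (count (mem (pol w)) (take k (enum 'I_n)))%:R.

(** The process [Y_k] described at the top: a constant at [k = 0], the number of selections at
    [k = n]. *)
Definition anticipated pol (k : nat) (w : T) : R :=
  nb_before pol k w + to_come k (state pol k w).

Definition best_gain pol (i : 'I_n) (w : T) : R :=
  gain d (to_come i.+1) (state pol i w) (X i w).

(** What the decision of [pol] at time [i] loses against the better option, once [X i] is seen. *)
Definition regret pol (i : 'I_n) (w : T) : R :=
  nb_before pol i w + best_gain pol i w - anticipated pol i.+1 w.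

Lemma take_enum_ordS (i : 'I_n) :
  take i.+1 (enum 'I_n) = rcons (take i (enum 'I_n)) i.
Proof. by rewrite (take_nth i) ?size_enum_ord// nth_ord_enum. Qed.

Lemma to_comeE (i : 'I_n) s :
  to_come i s = \int[law i]_x gain d (to_come i.+1) s x.
Proof. by rewrite /to_come (drop_nth i) ?size_enum_ord// nth_ord_enum. Qed.

Lemma to_come_n s : to_come n s = 0.
Proof. by rewrite /to_come drop_oversize// size_enum_ord. Qed.

Lemma to_comeP k : [/\ bounded_mfun (to_come k), forall s, 0 <= to_come k s &
  monotone_state (to_come k)].
Proof. exact: valueP. Qed.

Lemma stateS pol (i : 'I_n) w : state pol i.+1 w =
  if i \in pol w then push (state pol i w) (X i w) else state pol i w.
Proof. by rewrite /state take_enum_ordS foldl_rcons. Qed.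

Lemma nb_beforeS pol (i : 'I_n) w :
  nb_before pol i.+1 w = nb_before pol i w + (i \in pol w)%:R.
Proof. by rewrite /nb_before take_enum_ordS -cats1 count_cat/= addn0 natrD. Qed.

Lemma enum_filter (A : {set 'I_n}) : enum A = [seq i <- enum 'I_n | i \in A].
Proof. by rewrite [in RHS]enumT. Qed.

Lemma nb_before_n pol w : nb_before pol n w = nb_selected pol w.
Proof.
rewrite /nb_before take_oversize ?size_enum_ord// /nb_selected cardE.
by rewrite enum_filter size_filter.
Qed.

Lemma state_n pol w : state pol n w = blocks (selected_values X pol w).
Proof.
rewrite /state take_oversize ?size_enum_ord// /selected_values /blocks.
rewrite enum_filter; move: (0, 0%N) => s.
elim: (enum 'I_n) s => //= i e IH s.
by case: ifP => _; rewrite IH.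
Qed.

Lemma state_mono pol k l w : (k <= l)%N ->
  ((state pol k w).2 <= (state pol l w).2)%N.
Proof.
move=> kl; rewrite /state -(subnKC kl) takeD foldl_cat.
move: (foldl _ _ _) => s; elim: (take _ _) s => //= i e IH s.
by apply: leq_trans (IH _); case: ifP => // _; exact: push_ge.
Qed.

Lemma measurable_past_ext k (f : T -> R * nat) (a : T -> bool) (i : 'I_n) :
  (i < k)%N -> measurable_fun (setT : set (past X k)) f ->
  measurable_fun (setT : set (past X k)) a ->
  measurable_fun (setT : set (past X k))
    (fun w => if a w then push (f w) (X i w) else f w).
Proof.
move=> ik mf ma; apply: measurable_fun_ifT => //.
exact: (measurableT_comp measurable_push
  (measurable_fun_pair mf (measurable_past_X ik))).
Qed.

Lemma measurable_past_accept pol (i : 'I_n) : nonanticipating X pol ->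
  measurable_fun (setT : set (past X i.+1)) (fun w => i \in pol w).
Proof.
move=> /(_ i); rewrite history_past => pi.
apply: (measurable_fun_bool true); rewrite setTI.
by rewrite [X in measurable X](_ : _ = [set w | i \in pol w]).
Qed.

Lemma measurable_past_state pol k : nonanticipating X pol -> (k <= n)%N ->
  measurable_fun (setT : set (past X k)) (state pol k).
Proof.
move=> na; elim: k => [|k IH] kn.
  by rewrite /state take0; exact: measurable_cst.
pose i := Ordinal kn.
rewrite [X in measurable_fun _ X](_ : _ = fun w =>
    if i \in pol w then push (state pol i w) (X i w) else state pol i w);
    last first.
  by apply/funext => w; rewrite -stateS.
apply: (measurable_past_ext (f := state pol i) (ltnSn i)).
  by apply: measurable_fun_past_mono (IH (ltnW kn)); exact: leqnSn.
exact: (measurable_past_accept (i := i) na).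
Qed.

Lemma measurable_past_nb_before pol k : nonanticipating X pol -> (k <= n)%N ->
  measurable_fun (setT : set (past X k)) (nb_before pol k).
Proof.
move=> na; elim: k => [|k IH] kn.
  by rewrite /nb_before take0; exact: measurable_cst.
pose i := Ordinal kn.
rewrite [X in measurable_fun _ X](_ : _ = fun w =>
    nb_before pol i w + (if i \in pol w then 1 else 0)); last first.
  by apply/funext => w; rewrite (nb_beforeS pol i); case: ifP.
apply: measurable_funD.
  by apply: measurable_fun_past_mono (IH (ltnW kn)); exact: leqnSn.
apply: measurable_fun_ifT; [|exact: measurable_cst..].
exact: (measurable_past_accept (i := i) na).
Qed.

Lemma nb_before_ge0 pol k w : 0 <= nb_before pol k w.
Proof. exact: ler0n. Qed.

Lemma nb_before_le pol k w : nb_before pol k w <= n%:R.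
Proof.
rewrite ler_nat (leq_trans (count_size _ _))// size_take_min size_enum_ord.
exact: geq_minr.
Qed.

Section NonAnticipating.
Context (pol : T -> {set 'I_n}) (na : nonanticipating X pol).

Lemma bounded_nb_before k : (k <= n)%N -> bounded_mfun (nb_before pol k).
Proof.
move=> kn; split.
  exact: measurable_fun_past (measurable_past_nb_before na kn).
by exists n%:R => w; rewrite ger0_norm ?nb_before_ge0// nb_before_le.
Qed.

Lemma bounded_to_come_state k l : (k <= n)%N ->
  bounded_mfun (fun w => to_come l (state pol k w)).
Proof.
move=> kn; have [[mv [M vM]] _ _] := to_comeP l.
split; last by exists M => w.
apply: measurableT_comp mv _.
exact: measurable_fun_past (measurable_past_state na kn).
Qed.

Lemma bounded_anticipated k : (k <= n)%N -> bounded_mfun (anticipated pol k).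
Proof.
by move=> kn; apply: bounded_mfunD; [exact: bounded_nb_before|
  exact: bounded_to_come_state].
Qed.

Lemma bounded_best_gain (i : 'I_n) : bounded_mfun (best_gain pol i).
Proof.
have [bv v0 mv] := to_comeP i.+1.
have [mg [M gM]] := bounded_gain d bv v0 mv.
split; last by exists M => w; exact: (gM (state pol i w, X i w)).
have ms := measurable_fun_past (measurable_past_state na (ltnW (ltn_ord i))).
exact: (measurableT_comp mg (measurable_fun_pair ms (measurable_funP (X i)))).
Qed.

Lemma bounded_regret (i : 'I_n) : bounded_mfun (regret pol i).
Proof.
apply: bounded_mfunB; last exact: bounded_anticipated.
by apply: bounded_mfunD; [exact/bounded_nb_before/ltnW|exact: bounded_best_gain].
Qed.

Lemma Rintegral_best_gain (i : 'I_n) :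
  \int[P]_w best_gain pol i w = \int[P]_w to_come i (state pol i w).
Proof.
have [bv v0 mv] := to_comeP i.+1.
rewrite [LHS](Rintegral_past (f := fun z => gain d (to_come i.+1) z.1 z.2) indX
  (measurable_past_state na (ltnW (ltn_ord i)))).
- by apply: eq_Rintegral => w _; rewrite to_comeE.
- exact: bounded_gain.
- by move=> z; exact: le_trans (gain_ge _ _ _ _).
Qed.

(** By [Rintegral_best_gain], count plus best gain has the same mean as [anticipated] at time [i];
    only the regret changes the mean. *)
Lemma Rintegral_anticipatedS (i : 'I_n) :
  \int[P]_w anticipated pol i.+1 w =
  \int[P]_w anticipated pol i w - \int[P]_w regret pol i w.
Proof.
have bN := bounded_nb_before (ltnW (ltn_ord i)).
have bG := bounded_best_gain i.
rewrite RintegralB_bounded; [|exact: bounded_mfunD|exact: bounded_anticipated].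
rewrite RintegralD_bounded// Rintegral_best_gain.
rewrite -RintegralD_bounded//; last exact/bounded_to_come_state/ltnW.
by rewrite opprB addrC subrK.
Qed.

Lemma Rintegral_anticipated0 :
  \int[P]_w anticipated pol 0 w = to_come 0 (0, 0%N).
Proof.
rewrite -[RHS](Rintegral_probability_cst P); apply: eq_Rintegral => w _.
by rewrite /anticipated /nb_before /state take0 add0r.
Qed.

Lemma Rintegral_anticipatedn :
  \int[P]_w anticipated pol n w = \int[P]_w nb_selected pol w.
Proof.
by apply: eq_Rintegral => w _; rewrite /anticipated nb_before_n to_come_n addr0.
Qed.

End NonAnticipating.

(** The decision taken is one of the two options that [gain] compares: an acceptance is admissible
    because block counts never decrease and the final count is at most [d.+1]. *)
Lemma regret_ge0 pol (i : 'I_n) w : feasible d X pol -> 0 <= regret pol i w.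
Proof.
move=> [na mod]; rewrite subr_ge0 /anticipated nb_beforeS stateS -addrA lerD2l.
rewrite /best_gain; case: ifPn => iw; last by rewrite add0r gain_ge.
rewrite /gain le_max ifT ?lexx ?orbT//.
have /modalP := mod w; rewrite -state_n; apply: leq_trans.
by have := state_mono pol w (ltn_ord i); rewrite stateS iw.
Qed.

End Policies.

(** * The Bellman policy and the absence of mean regret for optimal policies *)

Section Optimality.
Context {disp : measure_display} {T : measurableType disp} {R : realType}
  (P : probability T R) {d n : nat} (X : 'I_n -> {RV P >-> R}).
Context (indX : mutually_independent X).

Local Notation to_come := (to_come (d := d) X).

Definition worth_taking (i : 'I_n) (s : R * nat) (x : R) : bool :=
  ((push s x).2 <= d.+1)%N && (to_come i.+1 s <= 1 + to_come i.+1 (push s x)).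

(** Given its own recursion, since [bellman] is defined from it; [bellman_stateE] identifies it with
    the state along [bellman]. *)
Definition bellman_state (k : nat) (w : T) : R * nat :=
  foldl (fun s i => if worth_taking i s (X i w) then push s (X i w) else s)
    (0, 0%N) (take k (enum 'I_n)).

Definition bellman (w : T) : {set 'I_n} :=
  [set i : 'I_n | worth_taking i (bellman_state i w) (X i w)]%SET.

Lemma bellman_stateE k w : (k <= n)%N ->
  state X bellman k w = bellman_state k w.
Proof.
elim: k => [_|k IH kn]; first by rewrite /state /bellman_state take0.
have := stateS X bellman (Ordinal kn) w; rewrite /= => ->.
rewrite (IH (ltnW kn)) inE /= /bellman_state.
by have := take_enum_ordS (Ordinal kn) => /= ->; rewrite foldl_rcons.
Qed.

Lemma measurable_worth_taking (i : 'I_n) :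
  measurable_fun setT (fun z : R * nat * R => worth_taking i z.1 z.2).
Proof.
have [[mv _] _ _] := to_comeP (d := d) X i.+1.
apply: measurable_and.
  apply: (measurableT_comp (measurable_fun_nat (fun k => (k <= d.+1)%N))).
  exact: measurableT_comp measurable_snd measurable_push.
apply: measurable_fun_ler; first exact: measurableT_comp mv _.
apply: measurable_funD; first exact: measurable_cst.
exact: measurableT_comp mv measurable_push.
Qed.

Lemma measurable_past_worth_taking (i : 'I_n) :
  measurable_fun (setT : set (past X i)) (bellman_state i) ->
  measurable_fun (setT : set (past X i.+1))
    (fun w => worth_taking i (bellman_state i w) (X i w)).
Proof.
move=> ms; have ms' := measurable_fun_past_mono (leqnSn i) ms.
exact: (measurableT_comp (measurable_worth_taking i)
  (measurable_fun_pair ms' (measurable_past_X (X := X) (ltnSn i)))).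
Qed.

Lemma measurable_past_bellman_state k : (k <= n)%N ->
  measurable_fun (setT : set (past X k)) (bellman_state k).
Proof.
elim: k => [|k IH] kn.
  by rewrite /bellman_state take0; exact: measurable_cst.
pose i := Ordinal kn.
rewrite [X in measurable_fun _ X](_ : _ = fun w =>
    if worth_taking i (bellman_state i w) (X i w)
    then push (bellman_state i w) (X i w) else bellman_state i w); last first.
  apply/funext => w; rewrite /bellman_state.
  by have := take_enum_ordS (Ordinal kn) => /= ->; rewrite foldl_rcons.
have ms := IH (ltnW kn).
apply: (measurable_past_ext (f := bellman_state i) (ltnSn i)).
  exact: measurable_fun_past_mono (leqnSn k) ms.
exact: (measurable_past_worth_taking (i := i) ms).
Qed.

Lemma bellman_feasible : feasible d X bellman.
Proof.
split=> [i|w].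
  rewrite history_past.
  have := measurable_past_worth_taking
    (measurable_past_bellman_state (ltnW (ltn_ord i))).
  move=> /(_ measurableT [set true] I); rewrite setTI.
  by congr (<<s _ >> _); apply/seteqP; split=> w /=; rewrite inE.
apply/modalP; rewrite -state_n bellman_stateE//.
suff : forall k, (k <= n)%N -> ((bellman_state k w).2 <= d.+1)%N by apply.
elim=> [_|k IH kn]; first by rewrite /bellman_state take0.
rewrite /bellman_state.
have := take_enum_ordS (Ordinal kn) => /= ->; rewrite foldl_rcons.
rewrite -/(bellman_state k w); case: ifP => [/andP[]//|_].
exact: IH (ltnW kn).
Qed.

Lemma bellman_regret (i : 'I_n) w : regret (d := d) X bellman i w = 0.
Proof.
apply/eqP; rewrite subr_eq0 /anticipated nb_beforeS stateS -addrA.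
rewrite (inj_eq (addrI _)) inE -(bellman_stateE w (ltnW (ltn_ord i))).
rewrite /best_gain /gain /worth_taking.
have [_ v0 _] := to_comeP (d := d) X i.+1.
case: ifP => /= _.
  case: ifP => h; [by rewrite max_r|rewrite add0r max_l//].
  by case: leP h => // /ltW.
(* Acceptance is forbidden here, and its conventional value [0] does not exceed the value of
   rejecting. *)
by rewrite add0r max_l.
Qed.

Lemma Rintegral_bellman :
  \int[P]_w nb_selected bellman w = to_come 0 (0, 0%N) :> R.
Proof.
have [na _] := bellman_feasible.
rewrite -(Rintegral_anticipatedn (d := d) X).
rewrite -(Rintegral_anticipated0 (d := d) X bellman).
suff : forall k, (k <= n)%N -> \int[P]_w anticipated (d := d) X bellman k w =
    \int[P]_w anticipated (d := d) X bellman 0 w by apply.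
elim=> [//|k IH kn].
have := Rintegral_anticipatedS (d := d) indX na (Ordinal kn).
rewrite /= => ->; rewrite IH ?(ltnW kn)//.
rewrite -[RHS]subr0 -[in RHS](Rintegral_probability_cst P 0); congr (_ - _).
by apply: eq_Rintegral => w _; exact: (bellman_regret (Ordinal kn)).
Qed.

Lemma expectation_nb_selected (pol : T -> {set 'I_n}) : nonanticipating X pol ->
  ('E_P[nb_selected pol : T -> R] = (\int[P]_w nb_selected pol w)%:E)%E.
Proof.
move=> na; rewrite unlock fineK//; apply: integrable_fin_num => //.
apply: bounded_mfun_integrable.
have := bounded_nb_before na (leqnn n).
by congr bounded_mfun; apply/funext => w; exact: nb_before_n.
Qed.

(** The means are nonincreasing in [k], start at the Bellman value and end at the mean of [pol],
    which optimality makes at least that of [bellman], again the Bellman value. *)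
Lemma optimal_anticipated (pol : T -> {set 'I_n}) k :
  optimal d X pol -> (k <= n)%N ->
  \int[P]_w anticipated (d := d) X pol k w = to_come 0 (0, 0%N).
Proof.
move=> [fpol opt] kn; have [na _] := fpol.
have antS l : (l < n)%N -> \int[P]_w anticipated (d := d) X pol l.+1 w <=
    \int[P]_w anticipated (d := d) X pol l w.
  move=> ln; have := Rintegral_anticipatedS (d := d) indX na (Ordinal ln).
  rewrite /= => ->; rewrite gerBl; apply: Rintegral_ge0 => w _.
  exact: (regret_ge0 (Ordinal ln)).
have ant m l : (m <= l)%N -> (l <= n)%N ->
    \int[P]_w anticipated (d := d) X pol l w <=
    \int[P]_w anticipated (d := d) X pol m w.
  elim: l => [|l IH]; first by rewrite leqn0 => /eqP ->.
  rewrite leq_eqVlt => /predU1P[->//|ml] ln.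
  exact: le_trans (antS _ ln) (IH ml (ltnW ln)).
apply/eqP; rewrite eq_le; apply/andP; split.
  by rewrite -(Rintegral_anticipated0 (d := d) X pol); exact: ant.
apply: le_trans (ant _ _ kn (leqnn n)).
rewrite Rintegral_anticipatedn -Rintegral_bellman -lee_fin.
have [nab _] := bellman_feasible.
rewrite -!expectation_nb_selected// opt; apply: ereal_sup_ubound.
by exists bellman => //; exact: bellman_feasible.
Qed.

(** Consecutive means of [anticipated] coincide. Since the regret is nonnegative, it vanishes almost
    surely; the vanishing integral is the form used later. *)
Lemma optimal_regret (pol : T -> {set 'I_n}) (i : 'I_n) : optimal d X pol ->
  \int[P]_w regret (d := d) X pol i w = 0.
Proof.
move=> opt; have [[na _] _] := opt.
have := Rintegral_anticipatedS (d := d) indX na i.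
rewrite (optimal_anticipated opt (ltn_ord i)).
rewrite (optimal_anticipated opt (ltnW (ltn_ord i))).
move=> /eqP; rewrite -[X in X == _]subr0 (inj_eq (addrI _)) eqr_opp.
by rewrite eq_sym => /eqP.
Qed.

(** The difference of the mean counts is the probability of selecting index [i]. The regret is
    removed first, then [X i] is averaged out, and finally the mean improvement is compared with
    that probability. *)
Lemma second_momentS (pol : T -> {set 'I_n}) (i : 'I_n) (c : R) :
  optimal d X pol ->
  \int[P]_w (anticipated (d := d) X pol i.+1 w - c) ^+ 2 <=
  \int[P]_w (anticipated (d := d) X pol i w - c) ^+ 2 +
  (\int[P]_w nb_before pol i.+1 w - \int[P]_w nb_before pol i w).
Proof.
move=> opt; have [[na mod] _] := opt; have iltn := ltnW (ltn_ord i).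
have bc : bounded_mfun (fun _ : T => c) := bounded_mfun_cst _.
have bN := bounded_nb_before na iltn.
have bN' := bounded_nb_before na (ltn_ord i).
have bY := bounded_anticipated (d := d) na iltn.
have bY' := bounded_anticipated (d := d) na (ltn_ord i).
have bG := bounded_best_gain (d := d) na i.
have bD := bounded_regret (d := d) na i.
have bV l := bounded_to_come_state (d := d) na l iltn.
have intD := optimal_regret i opt.
have [bv v0 mv] := to_comeP (d := d) X i.+1.
(* With [y] the deviation and [D] the regret, [y ^+ 2 <= (y + D) ^+ 2 + M * D] as soon as [M] bounds
   [|2 * y + D|], and [M * D] has integral zero. *)
have no_regret : \int[P]_w (anticipated (d := d) X pol i.+1 w - c) ^+ 2 <=
    \int[P]_w (nb_before pol i w - c + best_gain (d := d) X pol i w) ^+ 2.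
  have [_ [M HM]] : bounded_mfun (fun w =>
      (anticipated (d := d) X pol i.+1 w - c) *+ 2 + regret (d := d) X pol i w).
    by do 2?apply: bounded_mfunD => //; apply: bounded_mfunB.
  have bN2 : bounded_mfun (fun w =>
      (nb_before pol i w - c + best_gain (d := d) X pol i w) ^+ 2).
    apply: bounded_mfun_sqr; apply: bounded_mfunD => //; exact: bounded_mfunB.
  have bMD : bounded_mfun (fun w => M * regret (d := d) X pol i w).
    by apply: bounded_mfunM => //; exact: bounded_mfun_cst.
  rewrite -[leRHS]addr0 -(mulr0 M) -intD -RintegralZ_bounded//.
  rewrite -RintegralD_bounded//; apply: le_Rintegral_bounded.
  - apply: bounded_mfun_sqr; exact: bounded_mfunB.
  - exact: bounded_mfunD.
  - move=> w; have := HM w; have := regret_ge0 i w (conj na mod).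
    have -> : nb_before pol i w - c + best_gain (d := d) X pol i w =
      anticipated (d := d) X pol i.+1 w - c + regret (d := d) X pol i w.
      by rewrite /regret; ring.
    move: (anticipated _ _ _ _ - c) (regret _ _ _ _) => y D D0.
    rewrite ler_norml => /andP[yD _].
    have : 0 <= D * (M + (y *+ 2 + D)) by rewrite mulr_ge0//; lra.
    move=> H; rewrite -subr_ge0; apply: le_trans H _.
    by rewrite le_eqVlt; apply/orP; left; apply/eqP; ring.
apply: le_trans no_regret _.
have mW : measurable_fun (setT : set (past X i))
    (fun w => (nb_before pol i w : R, state X pol i w)).
  exact: (measurable_fun_pair (measurable_past_nb_before na iltn)
    (measurable_past_state na iltn)).
have [mg [M gM]] := bounded_gain d bv v0 mv.
(* Truncating the count makes the integrand a bounded function of the state. *)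
pose trunc (r : R) := Num.max 0 (Num.min r n%:R).
have truncE w : trunc (nb_before pol i w) = nb_before pol i w.
  by rewrite /trunc min_l ?nb_before_le// max_r// nb_before_ge0.
have mtrunc : measurable_fun setT trunc.
  apply: measurable_maxr; first exact: measurable_cst.
  by apply: measurable_minr => //; exact: measurable_cst.
have btrunc (r : R) : `|trunc r| <= n%:R.
  rewrite ger0_norm; last by rewrite le_max lexx.
  by rewrite ge_max ler0n ge_min lexx orbT.
pose f (z : R * (R * nat) * R) :=
  (trunc z.1.1 - c + gain d (to_come i.+1) z.1.2 z.2) ^+ 2.
have bf : bounded_mfun f.
  apply: bounded_mfun_sqr; apply: bounded_mfunD.
    apply: bounded_mfunB; last exact: bounded_mfun_cst.
    split; last by exists n%:R.
    apply: (measurableT_comp mtrunc).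
    exact: measurableT_comp measurable_fst measurable_fst.
  split; last by exists M => z; exact: (gM (z.1.2, z.2)).
  exact: (measurableT_comp mg (measurable_fun_pair
    (measurableT_comp measurable_snd measurable_fst) measurable_snd)).
have := Rintegral_past indX mW bf (fun z => sqr_ge0 _).
rewrite /f /=; under eq_Rintegral do rewrite truncE; move=> ->.
under eq_Rintegral do rewrite truncE.
have [mI [N IN]] := bounded_mfun_Rintegral (law X i) bf (fun z => sqr_ge0 _).
have bI : bounded_mfun (fun w => \int[distribution P (X i)]_x
    (nb_before pol i w - c + gain d (to_come i.+1) (state X pol i w) x) ^+ 2).
  rewrite [X in bounded_mfun X](_ : _ = fun w => \int[law X i]_x
      f ((nb_before pol i w, state X pol i w), x)); last first.
    by apply/funext => w; rewrite /f /= truncE.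
  split; last by exists N => w.
  exact: (measurableT_comp mI (measurable_fun_past mW)).
have bstep : bounded_mfun (fun w => (anticipated (d := d) X pol i w - c) ^+ 2 +
    (to_come i (state X pol i w) - to_come i.+1 (state X pol i w))).
  by apply: bounded_mfunD; [apply: bounded_mfun_sqr|]; exact: bounded_mfunB.
apply: (@le_trans _ _ (\int[P]_w ((anticipated (d := d) X pol i w - c) ^+ 2 +
    (to_come i (state X pol i w) - to_come i.+1 (state X pol i w))))).
  (* Pointwise [second_moment_gain], with [a] the count minus [c]. *)
  apply: le_Rintegral_bounded => // w.
  rewrite /anticipated addrAC to_comeE; exact: second_moment_gain.
rewrite RintegralD_bounded;
  [|exact/bounded_mfun_sqr/bounded_mfunB|exact: bounded_mfunB].
rewrite lerD2l RintegralB_bounded// -Rintegral_best_gain//.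
(* The best gain exceeds the value of staying in the current state by at most the regret plus the
   indicator of selection, because the next state is worth no more than the current one; the regret
   has mean zero. *)
have : \int[P]_w (best_gain (d := d) X pol i w + nb_before pol i w) <=
    \int[P]_w (regret (d := d) X pol i w + (nb_before pol i.+1 w +
      to_come i.+1 (state X pol i w))).
  apply: le_Rintegral_bounded => [||w].
  - exact: bounded_mfunD.
  - by apply: bounded_mfunD => //; exact: bounded_mfunD.
  - rewrite /regret /anticipated.
    have : to_come i.+1 (state X pol i.+1 w) <= to_come i.+1 (state X pol i w).
      by rewrite stateS; case: ifP => // _; exact/mv/dominates_push.
    lra.
rewrite [leRHS]RintegralD_bounded//; last exact: bounded_mfunD.
rewrite intD add0r !RintegralD_bounded//; lra.
Qed.

End Optimality.

(** * Summation of the increments into the variance bound *)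

Section Variance.
Context {disp : measure_display} {T : measurableType disp} {R : realType}
  (P : probability T R) {d n : nat} (X : 'I_n -> {RV P >-> R}).

(** Telescoping of [second_momentS] about the common mean of the process, from zero deviation at
    time 0. *)
Lemma second_moment_anticipated (pol : T -> {set 'I_n}) k :
  mutually_independent X -> optimal d X pol -> (k <= n)%N ->
  \int[P]_w (anticipated (d := d) X pol k w -
    to_come (d := d) X 0 (0, 0%N)) ^+ 2 <=
  \int[P]_w nb_before pol k w.
Proof.
move=> indX opt; elim: k => [_|k IH kn].
  rewrite (_ : \int[P]_w _ = 0).
    by apply: Rintegral_ge0 => w _; exact: ler0n.
  rewrite -[RHS](Rintegral_probability_cst P); apply: eq_Rintegral => w _.
  by rewrite /anticipated /nb_before /state take0 add0r subrr expr0n.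
apply: le_trans (second_momentS indX (Ordinal kn) _ opt) _ => /=.
by rewrite addrCA gerDl subr_le0; exact: IH (ltnW kn).
Qed.

End Variance.

Local Open Scope ereal_scope.

Theorem theorem4 (disp : measure_display) (T : measurableType disp)
    (R : realType) (P : probability T R) (d n : nat)
    (X : 'I_n -> {RV P >-> R}) (F : R -> R) (pol : T -> {set 'I_n}) :
  (1 <= n)%N ->
  mutually_independent X ->
  continuous F ->
  (forall (i : 'I_n) (x : R), cdf (X i) x = (F x)%:E) ->
  optimal d X pol ->
  'V_P[nb_selected pol : T -> R] <= 'E_P[nb_selected pol : T -> R].
Proof.
move=> _ indX _ _ opt; have [[na _] _] := opt.
have U_mean : (\int[P]_w nb_selected pol w = to_come (d := d) X 0 (0, 0%N))%R.
  by rewrite -(Rintegral_anticipatedn (d := d) X) optimal_anticipated.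
have bU := bounded_anticipated (d := d) na (leqnn n).
rewrite /variance unlock (expectation_nb_selected na) U_mean /= unlock.
(* At time [n] nothing is left to come, so the variance is the second moment of [anticipated] about
   its mean. *)
have -> : (\int[P]_w (((nb_selected pol \- cst (to_come (d := d) X 0 (0, 0%N))) *
    (nb_selected pol \- cst (to_come (d := d) X 0 (0, 0%N)))) w)%:E =
  (\int[P]_w (anticipated (d := d) X pol n w -
    to_come (d := d) X 0 (0, 0%N)) ^+ 2)%R%:E)%E.
  rewrite fineK.
    apply: eq_integral => w _; rewrite /anticipated nb_before_n to_come_n addr0.
    by rewrite expr2.
  apply: integrable_fin_num => //; apply: bounded_mfun_integrable.
  by apply: bounded_mfun_sqr; apply: bounded_mfunB => //; exact: bounded_mfun_cst.
rewrite lee_fin (le_trans (second_moment_anticipated indX opt (leqnn n)))//.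
rewrite -U_mean le_eqVlt; apply/orP; left; apply/eqP.
by apply: eq_Rintegral => w _; exact: nb_before_n.
Qed.
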